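(* For a 2-z-exact 2-category $\mathcal L$ the following conditions are equivalent. (i) $\mathcal L$ is homologically self-dual. (ii) For every totally normal sequence of 2-monomorphisms $A\xrightarrow{a}X\xrightarrow{c}B$, the induced sequence $\mathrm{Cok}(a)\to\mathrm{Cok}(c\circ a)\to\mathrm{Cok}(c)$ is short 2-exact. (iii) For every totally normal sequence of 2-epimorphisms $X\xrightarrow{p}Y\xrightarrow{q}Z$, the induced sequence $\mathrm{Ker}(p)\to\mathrm{Ker}(q\circ p)\to\mathrm{Ker}(q)$ is short 2-exact.
   Context: 2-categories are strict. For 1-cells, $\cong$ means that there is an invertible 2-cell between them. Whiskering is denoted $\star$. A bizero object of a 2-category $\mathcal L$ is an object $0$ such that for every object $A$ the hom-categories $\mathcal L(A,0)$ and $\mathcal L(0,A)$ are equivalent to the terminal category. A 1-cell is null if it factors through $0$; $f\cong 0$ means that $f$ is isomorphic to a null 1-cell. The bizero object is strong if between any two parallel 1-cells that factor through $0$ there is exactly one 2-cell. A 2-monomorphism is a 1-cell $f\colon A\to B$ such that for every object $Z$ the functor $f\circ(-)\colon\mathcal L(Z,A)\to\mathcal L(Z,B)$ is fully faithful; 2-epimorphisms are defined dually. In a 2-category with a strong bizero object, a 2-kernel of $f\colon A\to B$ is a 1-cell $k\colon K\to A$ with an invertible 2-cell $f\circ k\cong 0$ such that (1) for every $z\colon Z\to A$ with $f\circ z\cong0$ there is $u\colon Z\to K$ with $k\circ u\cong z$; (2) for all $u,v\colon Z\to K$ and every 2-cell $\lambda\colon k\circ u\Rightarrow k\circ v$ there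 is a unique 2-cell $\mu\colon u\Rightarrow v$ with $k\star\mu=\lambda$. 2-cokernels are defined dually. They are unique up to equivalence and are written $\ker(f)\colon\mathrm{Ker}(f)\to A$ and $\operatorname{coker}(f)\colon B\to\mathrm{Cok}(f)$. A 2-z-exact 2-category is a 2-category with a strong bizero object having all 2-kernels and all 2-cokernels. A normal 2-monomorphism is a 1-cell which is a 2-kernel of some 1-cell; a normal 2-epimorphism is a 1-cell which is a 2-cokernel of some 1-cell. A 1-cell is normal if it is isomorphic to $m\circ e$ with $e$ a normal 2-epimorphism and $m$ a normal 2-monomorphism. A short 2-exact sequence is a composable pair $(k,q)$ such that $k$ is a 2-kernel of $q$ and $q$ is a 2-cokernel of $k$. $\mathcal L$ is homologically self-dual if for every normal 2-monomorphism $m\colon K\to X$ and normal 2-epimorphism $e\colon X\to R$ with $e\circ m\cong 0$, the 1-cell $\operatorname{coker}(m)\circ\ker(e)\colon\mathrm{Ker}(e)\to\mathrm{Cok}(m)$ (the dinversion of $(m,e)$) is normal. A sequence of 2-monomorphisms $A\xrightarrow{a}X\xrightarrow{c}B$ is totally normal when $a$, $c$ and $c\circ a$ are all normal 2-monomorphisms. Dually, a sequence of 2-epimorphisms $X\xrightarrow{p}Y\xrightarrow{q}Z$ is totally normal when $p$, $q$ and $q\circ p$ are all normal 2-epimorphisms. In (ii) the induced 1-cells $u\colon\mathrm{Cok}(a)\to\mathrm{Cok}(c\circ a)$ and $v\colon\mathrm{Cok}(c\circ a)\to\mathrm{Cok}(c)$ are determined by $u\circ\operatorname{coker}(a)\cong\operatorname{coker}(c\circ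 a)\circ c$ and $v\circ\operatorname{coker}(c\circ a)\cong\operatorname{coker}(c)$. In (iii) the induced 1-cells $x\colon\mathrm{Ker}(p)\to\mathrm{Ker}(q\circ p)$ and $y\colon\mathrm{Ker}(q\circ p)\to\mathrm{Ker}(q)$ are determined by $\ker(q\circ p)\circ x\cong\ker(p)$ and $\ker(q)\circ y\cong p\circ\ker(q\circ p)$. *)

(* Defs.v *)
Set Implicit Arguments.
Unset Strict Implicit.
Unset Printing Implicit Defensive.

Declare Scope twocat_scope.
Delimit Scope twocat_scope with tc.

(** * Categories, functors, equivalences *)

Record category := Category {
  obj :> Type;
  mor : obj -> obj -> Type;
  idm : forall x, mor x x;
  compm : forall x y z, mor y z -> mor x y -> mor x z;
  compm_idl : forall x y (f : mor x y), compm (idm y) f = f;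
  compm_idr : forall x y (f : mor x y), compm f (idm x) = f;
  compmA : forall w x y z (h : mor y z) (g : mor x y) (f : mor w x),
    compm h (compm g f) = compm (compm h g) f
}.

Arguments mor {c} x y.
Arguments idm {c} x.
Arguments compm {c x y z} g f.

Definition is_iso (C : category) (x y : C) (f : mor x y) : Prop :=
  exists g : mor y x, compm g f = idm x /\ compm f g = idm y.

Definition isomorphic (C : category) (x y : C) : Prop :=
  exists f : mor x y, is_iso f.

Definition mor_of_eq (C : category) (x y : C) (e : x = y) : mor x y :=
  match e in _ = z return mor x z with eq_refl => idm x end.

Record functor (C D : category) := Functor {
  fobj :> C -> D;
  fmor : forall x y : C, mor x y -> mor (fobj x) (fobj y);
  fmor_id : forall x, fmor (idm x) = idm (fobj x);
  fmor_comp : forall x y z (g : mor y z) (f : mor x y),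
    fmor (compm g f) = compm (fmor g) (fmor f)
}.

Arguments fmor {C D} _ {x y} _.

Definition functor_id (C : category) : functor C C :=
  @Functor C C (fun x => x) (fun _ _ f => f)
    (fun _ => eq_refl) (fun _ _ _ _ _ => eq_refl).

Definition functor_comp (C D E : category) (G : functor D E) (F : functor C D) :
  functor C E.
Proof.
refine (@Functor C E (fun x => G (F x)) (fun _ _ f => fmor G (fmor F f)) _ _).
- intros x; rewrite fmor_id; apply fmor_id.
- intros x y z g f; rewrite fmor_comp; apply fmor_comp.
Defined.

Definition naturally_isomorphic (C D : category) (F G : functor C D) : Prop :=
  exists eta : forall x, mor (F x) (G x),
    (forall x, is_iso (eta x)) /\
    (forall x y (f : mor x y),
       compm (eta y) (fmor F f) = compm (fmor G f) (eta x)).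

Definition equivalent_categories (C D : category) : Prop :=
  exists (F : functor C D) (G : functor D C),
    naturally_isomorphic (functor_comp G F) (functor_id C) /\
    naturally_isomorphic (functor_comp F G) (functor_id D).

Definition terminal_category : category.
Proof.
refine (@Category unit (fun _ _ => unit) (fun _ => tt) (fun _ _ _ _ _ => tt)
          _ _ _).
- now intros x y [].
- now intros x y [].
- reflexivity.
Defined.

Definition faithful (C D : category) (F : functor C D) : Prop :=
  forall (x y : C) (f g : mor x y), fmor F f = fmor F g -> f = g.

Definition full (C D : category) (F : functor C D) : Prop :=
  forall (x y : C) (g : mor (F x) (F y)), exists f : mor x y, fmor F f = g.

Definition fully_faithful (C D : category) (F : functor C D) : Prop :=
  full F /\ faithful F.

(** * Strict 2-categories *)

(** Horizontal composition of 2-cells is presented through the two whiskerings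
    and the interchange law.  Composition of 1-cells is associative and unital
    up to Leibniz equality; since the two sides of each coherence law for
    2-cells live over equal but not convertible 1-cells, these laws are stated
    with the identity 2-cells [mor_of_eq] inserted. *)
Record twocat := Twocat {
  ob :> Type;
  hom : ob -> ob -> category;
  id1 : forall A, hom A A;
  comp1 : forall A B C, hom B C -> hom A B -> hom A C;
  whiskl : forall A B C (g : hom B C) (f f' : hom A B),
    mor f f' -> mor (comp1 g f) (comp1 g f');
  whiskr : forall A B C (g g' : hom B C),
    mor g g' -> forall f : hom A B, mor (comp1 g f) (comp1 g' f);
  comp1_idl : forall A B (f : hom A B), comp1 (id1 B) f = f;
  comp1_idr : forall A B (f : hom A B), comp1 f (id1 A) = f;
  comp1A : forall A B C D (h : hom C D) (g : hom B C) (f : hom A B),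
    comp1 h (comp1 g f) = comp1 (comp1 h g) f;
  whiskl_idm : forall A B C (g : hom B C) (f : hom A B),
    whiskl g (idm f) = idm (comp1 g f);
  whiskl_compm : forall A B C (g : hom B C) (f f' f'' : hom A B)
      (b : mor f' f'') (a : mor f f'),
    whiskl g (compm b a) = compm (whiskl g b) (whiskl g a);
  whiskr_idm : forall A B C (g : hom B C) (f : hom A B),
    whiskr (idm g) f = idm (comp1 g f);
  whiskr_compm : forall A B C (g g' g'' : hom B C)
      (b : mor g' g'') (a : mor g g') (f : hom A B),
    whiskr (compm b a) f = compm (whiskr b f) (whiskr a f);
  interchange : forall A B C (g g' : hom B C) (f f' : hom A B)
      (b : mor g g') (a : mor f f'),
    compm (whiskr b f') (whiskl g a) = compm (whiskl g' a) (whiskr b f);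
  whiskl_id1 : forall A B (f f' : hom A B) (a : mor f f'),
    compm (mor_of_eq (comp1_idl f')) (whiskl (id1 B) a)
    = compm a (mor_of_eq (comp1_idl f));
  whiskr_id1 : forall A B (f f' : hom A B) (a : mor f f'),
    compm (mor_of_eq (comp1_idr f')) (whiskr a (id1 A))
    = compm a (mor_of_eq (comp1_idr f));
  whiskl_comp1 : forall A B C D (h : hom C D) (g : hom B C) (f f' : hom A B)
      (a : mor f f'),
    compm (mor_of_eq (comp1A h g f')) (whiskl h (whiskl g a))
    = compm (whiskl (comp1 h g) a) (mor_of_eq (comp1A h g f));
  whisklr : forall A B C D (h : hom C D) (g g' : hom B C) (f : hom A B)
      (a : mor g g'),
    compm (mor_of_eq (comp1A h g' f)) (whiskl h (whiskr a f))
    = compm (whiskr (whiskl h a) f) (mor_of_eq (comp1A h g f));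
  whiskr_comp1 : forall A B C D (h h' : hom C D) (g : hom B C) (f : hom A B)
      (a : mor h h'),
    compm (mor_of_eq (comp1A h' g f)) (whiskr a (comp1 g f))
    = compm (whiskr (whiskr a g) f) (mor_of_eq (comp1A h g f))
}.

Arguments hom {t} A B.
Arguments id1 {t} A.
Arguments comp1 {t A B C} g f.
Arguments whiskl {t A B C} g {f f'} a.
Arguments whiskr {t A B C g g'} a f.

Notation "x ≅ y" := (isomorphic x y) (at level 70, no associativity)
  : twocat_scope.
Notation "g ∘ f" := (comp1 g f) (at level 40, left associativity)
  : twocat_scope.

Open Scope twocat_scope.

Definition postcomp (L : twocat) (A B : L) (f : hom A B) (Z : L) :
  functor (hom Z A) (hom Z B) :=
  @Functor (hom Z A) (hom Z B) (fun z => f ∘ z) (fun _ _ a => whiskl f a)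
    (fun z => whiskl_idm f z) (fun _ _ _ b a => whiskl_compm f b a).

Definition precomp (L : twocat) (A B : L) (f : hom A B) (Z : L) :
  functor (hom B Z) (hom A Z) :=
  @Functor (hom B Z) (hom A Z) (fun z => z ∘ f) (fun _ _ a => whiskr a f)
    (fun z => whiskr_idm z f) (fun _ _ _ b a => whiskr_compm b a f).

Definition is_2mono (L : twocat) (A B : L) (f : hom A B) : Prop :=
  forall Z : L, fully_faithful (postcomp f Z).

Definition is_2epi (L : twocat) (A B : L) (f : hom A B) : Prop :=
  forall Z : L, fully_faithful (precomp f Z).

(** * Bizero objects *)

Definition is_bizero (L : twocat) (O : L) : Prop :=
  forall A : L,
    equivalent_categories (hom A O) terminal_category /\
    equivalent_categories (hom O A) terminal_category.

(** Everything below is relative to a chosen bizero object [O]. *)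

Definition null (L : twocat) (O A B : L) (f : hom A B) : Prop :=
  exists (g : hom A O) (h : hom O B), f = h ∘ g.

Definition iso_null (L : twocat) (O A B : L) (f : hom A B) : Prop :=
  exists f0 : hom A B, null O f0 /\ f ≅ f0.

Definition is_strong_bizero (L : twocat) (O : L) : Prop :=
  is_bizero O /\
  forall (A B : L) (f g : hom A B), null O f -> null O g ->
    exists! a : mor f g, True.

(** * 2-kernels and 2-cokernels *)

(** When [O] is a strong bizero object, the invertible 2-cell from [f ∘ k] to a
    given null 1-cell is unique if it exists, so it is not recorded as data. *)
Definition is_2kernel (L : twocat) (O A B : L) (f : hom A B)
    (K : L) (k : hom K A) : Prop :=
  iso_null O (f ∘ k) /\
  (forall (Z : L) (z : hom Z A), iso_null O (f ∘ z) ->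
     exists u : hom Z K, k ∘ u ≅ z) /\
  (forall (Z : L) (u v : hom Z K) (l : mor (k ∘ u) (k ∘ v)),
     exists! m : mor u v, whiskl k m = l).

Definition is_2cokernel (L : twocat) (O A B : L) (f : hom A B)
    (Q : L) (q : hom B Q) : Prop :=
  iso_null O (q ∘ f) /\
  (forall (Z : L) (z : hom B Z), iso_null O (z ∘ f) ->
     exists u : hom Q Z, u ∘ q ≅ z) /\
  (forall (Z : L) (u v : hom Q Z) (l : mor (u ∘ q) (v ∘ q)),
     exists! m : mor u v, whiskr m q = l).

Definition is_2z_exact (L : twocat) (O : L) : Prop :=
  is_strong_bizero O /\
  (forall (A B : L) (f : hom A B),
     exists (K : L) (k : hom K A), is_2kernel O f k) /\
  (forall (A B : L) (f : hom A B),
     exists (Q : L) (q : hom B Q), is_2cokernel O f q).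

Definition normal_2mono (L : twocat) (O K A : L) (k : hom K A) : Prop :=
  exists (B : L) (f : hom A B), is_2kernel O f k.

Definition normal_2epi (L : twocat) (O B Q : L) (q : hom B Q) : Prop :=
  exists (A : L) (f : hom A B), is_2cokernel O f q.

Definition normal_1cell (L : twocat) (O A B : L) (f : hom A B) : Prop :=
  exists (I : L) (e : hom A I) (m : hom I B),
    normal_2epi O e /\ normal_2mono O m /\ f ≅ m ∘ e.

Definition short_2exact (L : twocat) (O A B C : L)
    (k : hom A B) (q : hom B C) : Prop :=
  is_2kernel O q k /\ is_2cokernel O k q.

(** 2-kernels, 2-cokernels and the 1-cells induced by their universal properties
    exist in a 2-z-exact 2-category and are determined only up to equivalence,
    resp. isomorphism; the conditions below quantify over all choices. *)

Definition homologically_self_dual (L : twocat) (O : L) : Prop :=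
  forall (K X R : L) (m : hom K X) (e : hom X R),
    normal_2mono O m -> normal_2epi O e -> iso_null O (e ∘ m) ->
    forall (Ke Qm : L) (ker_e : hom Ke X) (coker_m : hom X Qm),
      is_2kernel O e ker_e -> is_2cokernel O m coker_m ->
      normal_1cell O (coker_m ∘ ker_e).

Definition totally_normal_mono (L : twocat) (O A X B : L)
    (a : hom A X) (c : hom X B) : Prop :=
  (is_2mono a /\ is_2mono c) /\
  normal_2mono O a /\ normal_2mono O c /\ normal_2mono O (c ∘ a).

Definition totally_normal_epi (L : twocat) (O X Y Z : L)
    (p : hom X Y) (q : hom Y Z) : Prop :=
  (is_2epi p /\ is_2epi q) /\
  normal_2epi O p /\ normal_2epi O q /\ normal_2epi O (q ∘ p).

Definition cokernel_sequences_exact (L : twocat) (O : L) : Prop :=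
  forall (A X B : L) (a : hom A X) (c : hom X B),
    totally_normal_mono O a c ->
    forall (Qa Qca Qc : L)
      (coker_a : hom X Qa) (coker_ca : hom B Qca) (coker_c : hom B Qc),
      is_2cokernel O a coker_a ->
      is_2cokernel O (c ∘ a) coker_ca ->
      is_2cokernel O c coker_c ->
      forall (u : hom Qa Qca) (v : hom Qca Qc),
        u ∘ coker_a ≅ coker_ca ∘ c ->
        v ∘ coker_ca ≅ coker_c ->
        short_2exact O u v.

Definition kernel_sequences_exact (L : twocat) (O : L) : Prop :=
  forall (X Y Z : L) (p : hom X Y) (q : hom Y Z),
    totally_normal_epi O p q ->
    forall (Kp Kqp Kq : L)
      (ker_p : hom Kp X) (ker_qp : hom Kqp X) (ker_q : hom Kq Y),
      is_2kernel O p ker_p ->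
      is_2kernel O (q ∘ p) ker_qp ->
      is_2kernel O q ker_q ->
      forall (x : hom Kp Kqp) (y : hom Kqp Kq),
        ker_qp ∘ x ≅ ker_p ->
        ker_q ∘ y ≅ p ∘ ker_qp ->
        short_2exact O x y.

(* Main.v *)
Require Import Defs.
From Stdlib Require Import Setoid Morphisms.

(** The argument uses 1-cells only up to isomorphism, together with two facts:
    2-monomorphisms reflect isomorphisms and null 1-cells, and a normal
    2-monomorphism is a 2-kernel of each of its 2-cokernels
    ([normal_mono_kernel_of_coker]); dually for 2-epimorphisms.

    (i) implies (ii).  Given [a : A -> X] and [c : X -> B] totally normal, the
    1-cell [coker (c a) ∘ c] is the dinversion of the pair [(c a, coker c)],
    because [c] is a 2-kernel of [coker c].  Hence it is isomorphic to [m e] with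
    [e] a normal 2-epimorphism and [m] a normal 2-monomorphism.  Since [c a] is a
    2-kernel of [coker (c a)] and [c] is a 2-monomorphism, a 2-kernel of
    [coker (c a) ∘ c], hence of [e], is [a].  So [e] is a 2-cokernel of [a], and
    the induced [u] agrees with [m] up to an equivalence: it is a normal
    2-monomorphism.  That [v] is a 2-cokernel of [u] is a diagram chase valid for
    all composable [a] and [c] ([cokernel_of_induced]), and then [u] is a
    2-kernel of [v].

    (ii) implies (i).  If [e m] is null, then [m] is isomorphic to [ker e ∘ a]
    for some [a], and [(a, ker e)] is totally normal.  By (ii) the induced
    [u : Cok a -> Cok m] is a 2-kernel, so that [coker m ∘ ker e], which is
    isomorphic to [u ∘ coker a], is normal.

    Reversing the 1-cells of the 2-category exchanges 2-kernels with
    2-cokernels and (ii) with (iii), and it fixes (i).  The equivalence of (i)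
    and (iii) is therefore that of (i) and (ii) in [op]; the same device gives
    the statements about 2-epimorphisms. *)

Set Implicit Arguments.
Unset Strict Implicit.
Unset Printing Implicit Defensive.

(** * Isomorphisms in a category *)

Lemma is_iso_idm (C : category) (x : C) : is_iso (idm x).
Proof. exists (idm x); split; apply compm_idl. Qed.

Lemma is_iso_compm (C : category) (x y z : C) (g : mor y z) (f : mor x y) :
  is_iso g -> is_iso f -> is_iso (compm g f).
Proof.
intros [g' [Hg1 Hg2]] [f' [Hf1 Hf2]]; exists (compm f' g'); split.
- now rewrite compmA, <- (compmA f' g' g), Hg1, compm_idr.
- now rewrite compmA, <- (compmA g f f'), Hf2, compm_idr.
Qed.

Lemma is_iso_mor_of_eq (C : category) (x y : C) (e : x = y) :
  is_iso (mor_of_eq e).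
Proof. destruct e; apply is_iso_idm. Qed.

Lemma is_iso_fmor (C D : category) (F : functor C D) (x y : C) (f : mor x y) :
  is_iso f -> is_iso (fmor F f).
Proof.
intros [g [H1 H2]]; exists (fmor F g); split.
- now rewrite <- fmor_comp, H1, fmor_id.
- now rewrite <- fmor_comp, H2, fmor_id.
Qed.

Lemma is_iso_cancel_l (C : category) (x y z : C) (f : mor y z) (a b : mor x y) :
  is_iso f -> compm f a = compm f b -> a = b.
Proof.
intros [g [Hg _]] H.
now rewrite <- (compm_idl a), <- (compm_idl b), <- Hg, <- !compmA, H.
Qed.

Lemma is_iso_cancel_r (C : category) (x y z : C) (f : mor x y) (a b : mor y z) :
  is_iso f -> compm a f = compm b f -> a = b.
Proof.
intros [g [_ Hg]] H.
now rewrite <- (compm_idr a), <- (compm_idr b), <- Hg, !compmA, H.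
Qed.

Lemma is_iso_factor (C : category) (x y z : C) (g : mor y z) (a : mor x z) :
  is_iso g -> exists b : mor x y, compm g b = a.
Proof.
intros [g' [_ Hg]]; exists (compm g' a).
now rewrite compmA, Hg, compm_idl.
Qed.

Lemma fully_faithful_reflects_isomorphic (C D : category) (F : functor C D)
    (x y : C) :
  fully_faithful F -> F x ≅ F y -> x ≅ y.
Proof.
intros [Ful Fai] [f [g [Hgf Hfg]]].
destruct (Ful _ _ f) as [f' Hf]; destruct (Ful _ _ g) as [g' Hg].
exists f', g'; split; apply Fai; rewrite fmor_comp, fmor_id, Hf, Hg; assumption.
Qed.

Lemma isomorphic_refl (C : category) (x : C) : x ≅ x.
Proof. exists (idm x); apply is_iso_idm. Qed.

Lemma isomorphic_sym (C : category) (x y : C) : x ≅ y -> y ≅ x.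
Proof. intros [f [g [H1 H2]]]; exists g, f; now split. Qed.

Lemma isomorphic_trans (C : category) (x y z : C) : x ≅ y -> y ≅ z -> x ≅ z.
Proof. intros [f Hf] [g Hg]; exists (compm g f); now apply is_iso_compm. Qed.

#[export] Instance isomorphic_equivalence (C : category) :
  Equivalence (@isomorphic C).
Proof.
split; [exact (@isomorphic_refl C) | exact (@isomorphic_sym C)
       | exact (@isomorphic_trans C)].
Qed.

#[export] Instance comp1_proper (L : twocat) (A B C : L) :
  Proper (@isomorphic (hom B C) ==> @isomorphic (hom A B)
          ==> @isomorphic (hom A C)) (@comp1 L A B C).
Proof.
intros g g' [b Hb] f f' [a Ha]; transitivity (g ∘ f').
- exists (whiskl g a); exact (is_iso_fmor (postcomp g A) Ha).
- exists (whiskr b f'); exact (is_iso_fmor (precomp f' C) Hb).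
Qed.

(** * The 2-category with reversed 1-cells *)

(** Read backwards, the coherence laws of a 2-category become those of the
    2-category with reversed 1-cells. *)
Lemma mor_of_eq_conj_sym (C : category) (x y x' y' : C) (e : x = y)
    (e' : x' = y') (a : mor x x') (b : mor y y') :
  compm (mor_of_eq e') a = compm b (mor_of_eq e) ->
  compm (mor_of_eq (eq_sym e')) b = compm a (mor_of_eq (eq_sym e)).
Proof.
destruct e, e'; simpl; rewrite !compm_idl, !compm_idr; now symmetry.
Qed.

(** 1-cells are reversed and 2-cells keep their direction, so the hom-category
    from [A] to [B] is literally the one of [L] from [B] to [A]. *)
Definition op (L : twocat) : twocat.
Proof.
refine (@Twocat (ob L) (fun A B => hom B A) (fun A => id1 A)
  (fun A B C g f => f ∘ g)
  (fun A B C g f f' a => whiskr a g)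
  (fun A B C g g' b f => whiskl f b)
  (fun A B f => comp1_idr f) (fun A B f => comp1_idl f)
  (fun A B C D h g f => eq_sym (comp1A f g h))
  _ _ _ _ _ _ _ _ _ _).
- intros; apply whiskr_idm.
- intros; apply whiskr_compm.
- intros; apply whiskl_idm.
- intros; apply whiskl_compm.
- intros; symmetry; apply interchange.
- intros; apply whiskr_id1.
- intros; apply whiskl_id1.
- intros; apply mor_of_eq_conj_sym, whiskr_comp1.
- intros; apply mor_of_eq_conj_sym, whisklr.
- intros; apply mor_of_eq_conj_sym, whiskl_comp1.
Defined.

Lemma null_op (L : twocat) (O A B : L) (f : hom B A) :
  @null (op L) O A B f <-> null O f.
Proof. split; intros [g [h H]]; now exists h, g. Qed.

Lemma iso_null_op (L : twocat) (O A B : L) (f : hom B A) :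
  @iso_null (op L) O A B f <-> iso_null O f.
Proof.
split; intros [f0 [H0 H]]; exists f0; split; try exact H;
  now apply null_op.
Qed.

Lemma is_2kernel_op (L : twocat) (O A B K : L) (f : hom B A) (k : hom A K) :
  @is_2kernel (op L) O A B f K k <-> is_2cokernel O f k.
Proof.
split; intros [H1 [H2 H3]].
- split; [now apply iso_null_op in H1 | split; [|exact H3]].
  intros Z z Hz; apply H2; now apply iso_null_op.
- split; [now apply iso_null_op | split; [|exact H3]].
  intros Z z Hz; apply H2; now apply iso_null_op in Hz.
Qed.

Lemma is_2cokernel_op (L : twocat) (O A B Q : L) (f : hom B A) (q : hom Q B) :
  @is_2cokernel (op L) O A B f Q q <-> is_2kernel O f q.
Proof.
split; intros [H1 [H2 H3]].
- split; [now apply iso_null_op in H1 | split; [|exact H3]].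
  intros Z z Hz; apply H2; now apply iso_null_op.
- split; [now apply iso_null_op | split; [|exact H3]].
  intros Z z Hz; apply H2; now apply iso_null_op in Hz.
Qed.

Lemma normal_2mono_op (L : twocat) (O A K : L) (k : hom A K) :
  @normal_2mono (op L) O K A k <-> normal_2epi O k.
Proof. split; intros [B [f H]]; exists B, f; now apply is_2kernel_op. Qed.

Lemma normal_2epi_op (L : twocat) (O B Q : L) (q : hom Q B) :
  @normal_2epi (op L) O B Q q <-> normal_2mono O q.
Proof. split; intros [A [f H]]; exists A, f; now apply is_2cokernel_op. Qed.

Lemma normal_1cell_op (L : twocat) (O A B : L) (f : hom B A) :
  @normal_1cell (op L) O A B f <-> normal_1cell O f.
Proof.
split; intros [I [e [m [He [Hm H]]]]]; exists I, m, e.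
- apply normal_2epi_op in He; apply normal_2mono_op in Hm.
  now repeat split.
- apply normal_2epi_op in Hm; apply normal_2mono_op in He.
  now repeat split.
Qed.

Lemma is_strong_bizero_op (L : twocat) (O : L) :
  is_strong_bizero O -> @is_strong_bizero (op L) O.
Proof.
intros [HO HS]; split.
- intros A; destruct (HO A); now split.
- intros A B f g Hf Hg; apply (HS B A f g); now apply null_op.
Qed.

Lemma is_2z_exact_op (L : twocat) (O : L) :
  is_2z_exact O -> @is_2z_exact (op L) O.
Proof.
intros [HO [HK HQ]]; split; [now apply is_strong_bizero_op | split].
- intros A B f; destruct (HQ _ _ f) as [Q [q Hq]]; exists Q, q.
  now apply is_2kernel_op.
- intros A B f; destruct (HK _ _ f) as [K [k Hk]]; exists K, k.
  now apply is_2cokernel_op.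
Qed.

Lemma short_2exact_op (L : twocat) (O A B C : L) (k : hom B A) (q : hom C B) :
  @short_2exact (op L) O A B C k q <-> short_2exact O q k.
Proof.
unfold short_2exact; split; intros [H1 H2]; split.
- now apply is_2cokernel_op.
- now apply is_2kernel_op.
- now apply is_2kernel_op.
- now apply is_2cokernel_op.
Qed.

Lemma homologically_self_dual_op (L : twocat) (O : L) :
  @homologically_self_dual (op L) O <-> homologically_self_dual O.
Proof.
split; intros H K X R m e Hm He Hem Ke Qm ke qm Hke Hqm.
- apply normal_1cell_op.
  apply (H R X K e m); try (now apply normal_2mono_op);
    try (now apply normal_2epi_op); try (now apply iso_null_op).
  + now apply is_2kernel_op.
  + now apply is_2cokernel_op.
- apply normal_1cell_op.
  apply normal_2mono_op in Hm; apply normal_2epi_op in He.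
  apply iso_null_op in Hem; apply is_2kernel_op in Hke.
  apply is_2cokernel_op in Hqm.
  now apply (H R X K e m).
Qed.

Lemma totally_normal_mono_op (L : twocat) (O A X B : L) (a : hom X A)
    (c : hom B X) :
  @totally_normal_mono (op L) O A X B a c <-> totally_normal_epi O c a.
Proof.
split; intros [[H1 H2] [H3 [H4 H5]]];
  apply normal_2mono_op in H3, H4, H5; (split; [split; assumption | now repeat split]).
Qed.

Lemma cokernel_sequences_exact_op (L : twocat) (O : L) :
  @cokernel_sequences_exact (op L) O <-> kernel_sequences_exact O.
Proof.
split.
- intros H X Y Z p q Hpq Kp Kqp Kq kp kqp kq Hkp Hkqp Hkq x y Hx Hy.
  apply short_2exact_op.
  apply totally_normal_mono_op in Hpq.
  apply is_2cokernel_op in Hkp, Hkqp, Hkq.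
  exact (H _ _ _ q p Hpq _ _ _ kq kqp kp Hkq Hkqp Hkp y x Hy Hx).
- intros H A X B a c Hac Qa Qca Qc qa qca qc Hqa Hqca Hqc u v Hu Hv.
  apply short_2exact_op.
  apply totally_normal_mono_op in Hac.
  apply is_2cokernel_op in Hqa, Hqca, Hqc.
  exact (H _ _ _ c a Hac _ _ _ qc qca qa Hqc Hqca Hqa v u Hv Hu).
Qed.

(** * 2-monomorphisms and 2-epimorphisms *)

(** A 1-cell is 2-faithful if postcomposition with it is faithful on 2-cells. *)
Definition is_2faithful (L : twocat) (A B : L) (f : hom A B) : Prop :=
  forall Z : L, faithful (postcomp f Z).

Lemma is_2mono_2faithful (L : twocat) (A B : L) (f : hom A B) :
  is_2mono f -> is_2faithful f.
Proof. intros H Z; apply H. Qed.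

Lemma is_iso_whiskr (L : twocat) (A B C : L) (g g' : hom B C) (b : mor g g')
    (f : hom A B) :
  is_iso b -> is_iso (whiskr b f).
Proof. exact (@is_iso_fmor _ _ (precomp f C) _ _ b). Qed.

Lemma is_2faithful_isomorphic (L : twocat) (A B : L) (f g : hom A B) :
  f ≅ g -> is_2faithful f -> is_2faithful g.
Proof.
intros [t Ht] Hf Z u v a b Hab; apply (Hf Z u v); simpl in *.
apply (is_iso_cancel_l (is_iso_whiskr v Ht)).
now rewrite !interchange, Hab.
Qed.

Lemma is_2mono_isomorphic (L : twocat) (A B : L) (f g : hom A B) :
  f ≅ g -> is_2mono f -> is_2mono g.
Proof.
intros Hfg Hf Z; split.
2: now apply (is_2faithful_isomorphic Hfg), is_2mono_2faithful.
destruct Hfg as [t Ht].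
intros u v l; simpl in *.
destruct (is_iso_factor (compm l (whiskr t u)) (is_iso_whiskr v Ht))
  as [l' Hl'].
destruct (proj1 (Hf Z) u v l') as [a Ha]; simpl in Ha.
exists a; apply (is_iso_cancel_r (is_iso_whiskr u Ht)).
now rewrite <- Hl', <- Ha, interchange.
Qed.

Lemma is_2faithful_right (L : twocat) (A B C : L) (g : hom B C) (f : hom A B) :
  is_2faithful (g ∘ f) -> is_2faithful f.
Proof.
intros H Z u v a b Hab; apply (H Z u v); simpl in *.
apply (is_iso_cancel_r (is_iso_mor_of_eq (comp1A g f u))).
now rewrite <- !whiskl_comp1, Hab.
Qed.

Lemma is_2mono_right (L : twocat) (A B C : L) (g : hom B C) (f : hom A B) :
  is_2mono (g ∘ f) -> is_2faithful g -> is_2mono f.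
Proof.
intros H Hg Z; split.
2: now apply (is_2faithful_right (g := g)), is_2mono_2faithful.
intros u v l; simpl in *.
(* [l'] is [whiskl g l] transported along associativity; it comes from a
   2-cell [a : u => v], and [whiskl f a = l] because [g] is 2-faithful. *)
destruct (is_iso_factor
  (compm (whiskl g l) (mor_of_eq (eq_sym (comp1A g f u))))
  (is_iso_mor_of_eq (eq_sym (comp1A g f v)))) as [l' Hl'].
destruct (proj1 (H Z) u v l') as [a Ha]; simpl in Ha.
exists a; apply (Hg Z); simpl.
apply (is_iso_cancel_r (is_iso_mor_of_eq (eq_sym (comp1A g f u)))).
rewrite <- Hl', <- Ha; symmetry.
apply mor_of_eq_conj_sym, whiskl_comp1.
Qed.

Lemma is_2mono_comp1 (L : twocat) (A B C : L) (g : hom B C) (f : hom A B) :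
  is_2mono g -> is_2mono f -> is_2mono (g ∘ f).
Proof.
intros Hg Hf Z; split; intros u v.
- intros l; simpl in *.
  destruct (is_iso_factor (compm l (mor_of_eq (comp1A g f u)))
    (is_iso_mor_of_eq (comp1A g f v))) as [l' Hl'].
  destruct (proj1 (Hg Z) _ _ l') as [b Hb].
  destruct (proj1 (Hf Z) _ _ b) as [a Ha]; simpl in *.
  exists a; apply (is_iso_cancel_r (is_iso_mor_of_eq (comp1A g f u))).
  now rewrite <- whiskl_comp1, Ha, Hb.
- intros a b Hab; simpl in *.
  apply (proj2 (Hf Z)), (proj2 (Hg Z)); simpl.
  apply (is_iso_cancel_l (is_iso_mor_of_eq (comp1A g f v))).
  now rewrite !whiskl_comp1, Hab.
Qed.

Lemma is_2mono_id1 (L : twocat) (A : L) : is_2mono (id1 A).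
Proof.
intros Z; split; intros u v.
- intros l; simpl in *.
  destruct (is_iso_factor (compm l (mor_of_eq (eq_sym (comp1_idl u))))
    (is_iso_mor_of_eq (eq_sym (comp1_idl v)))) as [a Ha].
  exists a; apply (is_iso_cancel_r (is_iso_mor_of_eq (eq_sym (comp1_idl u)))).
  rewrite <- Ha; symmetry; apply mor_of_eq_conj_sym, whiskl_id1.
- intros a b Hab; simpl in *.
  apply (is_iso_cancel_r (is_iso_mor_of_eq (comp1_idl u))).
  now rewrite <- !whiskl_id1, Hab.
Qed.

Lemma is_2mono_equivalence (L : twocat) (A B : L) (w : hom A B) (w' : hom B A) :
  w' ∘ w ≅ id1 A -> w ∘ w' ≅ id1 B -> is_2mono w.
Proof.
intros H1 H2; apply (is_2mono_right (g := w')).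
- apply (is_2mono_isomorphic (isomorphic_sym H1)), is_2mono_id1.
- apply (is_2faithful_right (g := w)).
  apply (is_2faithful_isomorphic (isomorphic_sym H2)).
  apply is_2mono_2faithful, is_2mono_id1.
Qed.

Lemma is_2mono_cancel (L : twocat) (A B Z : L) (f : hom A B) (u v : hom Z A) :
  is_2mono f -> f ∘ u ≅ f ∘ v -> u ≅ v.
Proof. intros H; exact (fully_faithful_reflects_isomorphic (H Z)). Qed.

Lemma is_2epi_cancel (L : twocat) (A B Z : L) (f : hom A B) (u v : hom B Z) :
  is_2epi f -> u ∘ f ≅ v ∘ f -> u ≅ v.
Proof. intros H; exact (fully_faithful_reflects_isomorphic (H Z)). Qed.

(** The dual of [is_2mono_right], in the form in which it is applied. *)
Lemma is_2epi_left (L : twocat) (A B C : L) (g : hom B C) (f : hom A B)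
    (h : hom A C) :
  g ∘ f ≅ h -> is_2epi h -> is_2epi f -> is_2epi g.
Proof.
intros Hh H Hf.
apply (@is_2mono_right (op L) C B A f g).
- exact (@is_2mono_isomorphic (op L) C A h (g ∘ f) (isomorphic_sym Hh) H).
- exact (@is_2mono_2faithful (op L) B A f Hf).
Qed.

(** * Null 1-cells *)

#[export] Instance iso_null_proper (L : twocat) (O A B : L) :
  Proper (@isomorphic (hom A B) ==> iff) (@iso_null L O A B).
Proof.
intros f g Hfg; split; intros [f0 [H0 H]]; exists f0; split; auto.
- now rewrite <- Hfg.
- now rewrite Hfg.
Qed.

Lemma iso_null_compl (L : twocat) (O A B C : L) (g : hom B C) (f : hom A B) :
  iso_null O f -> iso_null O (g ∘ f).
Proof.
intros [f0 [[x [y Hxy]] H]]; exists (g ∘ f0); split.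
- exists x, (g ∘ y); now rewrite Hxy, comp1A.
- now rewrite H.
Qed.

Lemma iso_null_compr (L : twocat) (O A B C : L) (g : hom B C) (f : hom A B) :
  iso_null O g -> iso_null O (g ∘ f).
Proof.
intros [g0 [[x [y Hxy]] H]]; exists (g0 ∘ f); split.
- exists (x ∘ f), y; now rewrite Hxy, comp1A.
- now rewrite H.
Qed.

Lemma null_isomorphic (L : twocat) (O A B : L) (f g : hom A B) :
  is_strong_bizero O -> null O f -> null O g -> f ≅ g.
Proof.
intros [_ HS] Hf Hg.
destruct (HS _ _ f g Hf Hg) as [a _]; destruct (HS _ _ g f Hg Hf) as [b _].
destruct (HS _ _ f f Hf Hf) as [i [_ Hi]].
destruct (HS _ _ g g Hg Hg) as [j [_ Hj]].
exists a, b; split.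
- now rewrite <- (Hi (compm b a) I), <- (Hi (idm f) I).
- now rewrite <- (Hj (compm a b) I), <- (Hj (idm g) I).
Qed.

Lemma iso_null_isomorphic (L : twocat) (O A B : L) (f g : hom A B) :
  is_strong_bizero O -> iso_null O f -> iso_null O g -> f ≅ g.
Proof.
intros HO [f0 [Hf0 Hf]] [g0 [Hg0 Hg]]; rewrite Hf, Hg.
now apply (null_isomorphic HO).
Qed.

Lemma exists_iso_null (L : twocat) (O A B : L) :
  is_strong_bizero O -> exists f : hom A B, iso_null O f.
Proof.
intros [HO _].
destruct (HO A) as [[_ [G _]] _]; destruct (HO B) as [_ [_ [G' _]]].
exists (G' tt ∘ G tt), (G' tt ∘ G tt); split; [|reflexivity].
now exists (G tt), (G' tt).
Qed.

Lemma is_2mono_reflects_null (L : twocat) (O A B Z : L) (f : hom A B)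
    (z : hom Z A) :
  is_strong_bizero O -> is_2mono f -> iso_null O (f ∘ z) -> iso_null O z.
Proof.
intros HO Hf Hz; destruct (exists_iso_null Z A HO) as [n Hn].
assert (H : z ≅ n).
{ apply (is_2mono_cancel Hf), (iso_null_isomorphic HO); trivial.
  now apply iso_null_compl. }
now rewrite H.
Qed.

Lemma is_2epi_reflects_null (L : twocat) (O A B Z : L) (f : hom A B)
    (z : hom B Z) :
  is_strong_bizero O -> is_2epi f -> iso_null O (z ∘ f) -> iso_null O z.
Proof.
intros HO Hf Hz; apply iso_null_op.
apply (@is_2mono_reflects_null (op L) O B A Z f z).
- now apply is_strong_bizero_op.
- exact Hf.
- now apply iso_null_op.
Qed.

(** * 2-kernels and 2-cokernels *)

(** The third clause in the definition of a 2-kernel says that it is a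
    2-monomorphism. *)
Lemma is_2kernel_iff (L : twocat) (O A B K : L) (f : hom A B) (k : hom K A) :
  is_2kernel O f k <->
  iso_null O (f ∘ k) /\
  (forall (Z : L) (z : hom Z A), iso_null O (f ∘ z) ->
     exists u : hom Z K, k ∘ u ≅ z) /\
  is_2mono k.
Proof.
split; intros [H1 [H2 H3]]; repeat split; trivial.
- intros u v l; destruct (H3 _ u v l) as [m [Hm _]]; now exists m.
- intros u v a b Hab; destruct (H3 _ u v (whiskl k a)) as [m [_ Hm]].
  now rewrite <- (Hm a eq_refl), (Hm b (eq_sym Hab)).
- intros Z u v l; destruct (H3 Z) as [Ful Fai].
  destruct (Ful u v l) as [m Hm]; exists m; split; [exact Hm|].
  intros m' Hm'; apply Fai; exact (eq_trans Hm (eq_sym Hm')).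
Qed.

Lemma is_2cokernel_iff (L : twocat) (O A B Q : L) (f : hom A B) (q : hom B Q) :
  is_2cokernel O f q <->
  iso_null O (q ∘ f) /\
  (forall (Z : L) (z : hom B Z), iso_null O (z ∘ f) ->
     exists u : hom Q Z, u ∘ q ≅ z) /\
  is_2epi q.
Proof.
rewrite <- is_2kernel_op, is_2kernel_iff, iso_null_op.
split; intros [H1 [H2 H3]]; split; trivial; split; trivial;
  intros Z z Hz; apply H2; apply iso_null_op in Hz; trivial.
Qed.

Lemma is_2kernel_2mono (L : twocat) (O A B K : L) (f : hom A B) (k : hom K A) :
  is_2kernel O f k -> is_2mono k.
Proof. intros H; now apply is_2kernel_iff in H. Qed.

Lemma is_2cokernel_2epi (L : twocat) (O A B Q : L) (f : hom A B) (q : hom B Q) :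
  is_2cokernel O f q -> is_2epi q.
Proof. intros H; now apply is_2cokernel_iff in H. Qed.

Lemma normal_2mono_2mono (L : twocat) (O K A : L) (k : hom K A) :
  normal_2mono O k -> is_2mono k.
Proof. intros [B [f H]]; exact (is_2kernel_2mono H). Qed.

Lemma is_2kernel_isomorphic (L : twocat) (O A B K : L) (f : hom A B)
    (k k' : hom K A) :
  k ≅ k' -> is_2kernel O f k -> is_2kernel O f k'.
Proof.
intros Hk H; apply is_2kernel_iff in H; apply is_2kernel_iff.
destruct H as [H1 [H2 H3]]; split; [|split].
- now rewrite <- Hk.
- intros Z z Hz; destruct (H2 Z z Hz) as [u Hu]; exists u; now rewrite <- Hk.
- exact (is_2mono_isomorphic Hk H3).
Qed.

Lemma is_2cokernel_isomorphic_arg (L : twocat) (O A B Q : L) (f f' : hom A B)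
    (q : hom B Q) :
  f ≅ f' -> is_2cokernel O f q -> is_2cokernel O f' q.
Proof.
intros Hf [H1 [H2 H3]]; split; [|split; trivial].
- now rewrite <- Hf.
- intros Z z Hz; apply H2; now rewrite Hf.
Qed.

Lemma normal_mono_kernel_of_coker (L : twocat) (O K A Q : L) (k : hom K A)
    (q : hom A Q) :
  normal_2mono O k -> is_2cokernel O k q -> is_2kernel O q k.
Proof.
intros [B [f [Hk1 [Hk2 Hk3]]]] [Hq1 [Hq2 _]]; split; [trivial|split; trivial].
intros Z z Hz; apply Hk2.
destruct (Hq2 B f Hk1) as [t Ht].
rewrite <- Ht, <- comp1A; now apply iso_null_compl.
Qed.

Lemma normal_epi_coker_of_kernel (L : twocat) (O K A Q : L) (k : hom K A)
    (q : hom A Q) :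
  normal_2epi O q -> is_2kernel O q k -> is_2cokernel O k q.
Proof.
intros Hq Hk; apply is_2kernel_op.
apply (@normal_mono_kernel_of_coker (op L) O Q A K q k).
- now apply normal_2mono_op.
- now apply is_2cokernel_op.
Qed.

Lemma is_2kernel_2mono_comp1 (L : twocat) (O A B C K : L) (m : hom B C)
    (f : hom A B) (k : hom K A) :
  is_strong_bizero O -> is_2mono m -> is_2kernel O (m ∘ f) k -> is_2kernel O f k.
Proof.
intros HO Hm [H1 [H2 H3]]; split; [|split; trivial].
- apply (is_2mono_reflects_null HO Hm); now rewrite comp1A.
- intros Z z Hz; apply H2; rewrite <- comp1A; now apply iso_null_compl.
Qed.

(** The 2-kernel of [f ∘ c] is the pullback along [c] of the 2-kernel of [f],
    computed here for a 2-monomorphism [c] and a factorization of the 2-kernel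
    of [f] through [c]. *)
Lemma is_2kernel_factor (L : twocat) (O A X B C : L) (a : hom A X) (c : hom X B)
    (k : hom A B) (f : hom B C) :
  is_2mono c -> c ∘ a ≅ k -> is_2kernel O f k -> is_2kernel O (f ∘ c) a.
Proof.
intros Hc Ha Hk; apply is_2kernel_iff in Hk; apply is_2kernel_iff.
destruct Hk as [H1 [H2 H3]]; split; [|split].
- now rewrite <- comp1A, Ha.
- intros Z z Hz; rewrite <- comp1A in Hz.
  destruct (H2 Z _ Hz) as [u Hu]; exists u.
  apply (is_2mono_cancel Hc); now rewrite comp1A, Ha.
- apply (is_2mono_right (g := c)); [|now apply is_2mono_2faithful].
  exact (is_2mono_isomorphic (isomorphic_sym Ha) H3).
Qed.

Lemma is_2cokernel_unique (L : twocat) (O A B Q Q' : L) (f : hom A B)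
    (q : hom B Q) (q' : hom B Q') :
  is_2cokernel O f q -> is_2cokernel O f q' ->
  exists (w : hom Q Q') (w' : hom Q' Q),
    w ∘ q ≅ q' /\ w' ∘ w ≅ id1 Q /\ w ∘ w' ≅ id1 Q'.
Proof.
intros Hq Hq'.
pose proof (is_2cokernel_2epi Hq) as Eq; pose proof (is_2cokernel_2epi Hq') as Eq'.
destruct Hq as [Hq1 [Hq2 _]]; destruct Hq' as [Hq1' [Hq2' _]].
destruct (Hq2 _ q' Hq1') as [w Hw]; destruct (Hq2' _ q Hq1) as [w' Hw'].
exists w, w'; split; [trivial|split].
- apply (is_2epi_cancel Eq); now rewrite <- comp1A, Hw, Hw', comp1_idl.
- apply (is_2epi_cancel Eq'); now rewrite <- comp1A, Hw', Hw, comp1_idl.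
Qed.

Lemma is_2kernel_equivalence (L : twocat) (O A B K K' : L) (f : hom A B)
    (k : hom K A) (w : hom K' K) (w' : hom K K') :
  w' ∘ w ≅ id1 K' -> w ∘ w' ≅ id1 K ->
  is_2kernel O f k -> is_2kernel O f (k ∘ w).
Proof.
intros H1 H2 Hk; apply is_2kernel_iff in Hk; apply is_2kernel_iff.
destruct Hk as [Hk1 [Hk2 Hk3]]; split; [|split].
- rewrite comp1A; now apply iso_null_compr.
- intros Z z Hz; destruct (Hk2 Z z Hz) as [u Hu]; exists (w' ∘ u).
  now rewrite <- comp1A, (comp1A w w' u), H2, comp1_idl.
- apply is_2mono_comp1; [trivial|exact (is_2mono_equivalence H1 H2)].
Qed.

(** * Homological self-duality *)

(** Exactness on the right of the sequence of 2-cokernels needs no normality. *)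
Lemma cokernel_of_induced (L : twocat) (O A X B Qa Qca Qc : L)
    (a : hom A X) (c : hom X B)
    (qa : hom X Qa) (qca : hom B Qca) (qc : hom B Qc)
    (u : hom Qa Qca) (v : hom Qca Qc) :
  is_strong_bizero O ->
  is_2cokernel O a qa -> is_2cokernel O (c ∘ a) qca -> is_2cokernel O c qc ->
  u ∘ qa ≅ qca ∘ c -> v ∘ qca ≅ qc ->
  is_2cokernel O u v.
Proof.
intros HO Hqa Hqca Hqc Hu Hv.
pose proof (is_2cokernel_2epi Hqa) as Eqa.
pose proof (is_2cokernel_2epi Hqca) as Eqca.
pose proof (is_2cokernel_2epi Hqc) as Eqc.
destruct Hqc as [Hqc1 [Hqc2 _]].
apply is_2cokernel_iff; split; [|split].
- apply (is_2epi_reflects_null HO Eqa).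
  now rewrite <- comp1A, Hu, comp1A, Hv.
- intros Z z Hz.
  assert (Hn : iso_null O (z ∘ qca ∘ c)).
  { rewrite <- comp1A, <- Hu, comp1A; now apply iso_null_compr. }
  destruct (Hqc2 _ _ Hn) as [t Ht]; exists t.
  apply (is_2epi_cancel Eqca); now rewrite <- comp1A, Hv.
- exact (is_2epi_left Hv Eqc Eqca).
Qed.

Lemma self_dual_cokernel_sequences (L : twocat) (O : L) :
  is_strong_bizero O ->
  homologically_self_dual O -> cokernel_sequences_exact O.
Proof.
intros HO H A X B a c [[_ Mc] [_ [Nc Nca]]] Qa Qca Qc qa qca qc Hqa Hqca Hqc
  u v Hu Hv.
pose proof (cokernel_of_induced HO Hqa Hqca Hqc Hu Hv) as Huv.
split; [|exact Huv].
apply normal_mono_kernel_of_coker; [|exact Huv].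
(* The dinversion of [(c ∘ a, qc)] is [qca ∘ c]. *)
destruct (H A B Qc (c ∘ a) qc) with (ker_e := c) (coker_m := qca)
  as [I [e [m [He [Hm Hme]]]]].
- exact Nca.
- now exists X, c.
- rewrite comp1A; apply iso_null_compr, Hqc.
- now apply normal_mono_kernel_of_coker.
- exact Hqca.
- (* [a] is a 2-kernel of [m ∘ e], hence of [e]. *)
  assert (Ha : is_2kernel O e a).
  { apply (is_2kernel_2mono_comp1 (m := m) HO (normal_2mono_2mono Hm)).
    pose proof (is_2kernel_factor Mc (isomorphic_refl (c ∘ a))
      (normal_mono_kernel_of_coker Nca Hqca)) as [K1 [K2 K3]].
    split; [|split; [|exact K3]].
    - now rewrite <- Hme.
    - intros Z z Hz; apply K2; now rewrite Hme. }
  destruct (is_2cokernel_unique Hqa (normal_epi_coker_of_kernel He Ha))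
    as [w [w' [Hw [Hww' Hw'w]]]].
  assert (Huw : m ∘ w ≅ u).
  { apply (is_2epi_cancel (is_2cokernel_2epi Hqa)).
    now rewrite <- comp1A, Hw, Hu. }
  destruct Hm as [C [g Hg]]; exists C, g.
  apply (is_2kernel_isomorphic Huw), (is_2kernel_equivalence Hww' Hw'w Hg).
Qed.

Lemma cokernel_sequences_self_dual (L : twocat) (O : L) :
  is_2z_exact O ->
  cokernel_sequences_exact O -> homologically_self_dual O.
Proof.
intros [HO [_ HQ]] H K X R m e Nm Ne Hem Ke Qm ke qm Hke Hqm.
pose proof (is_2kernel_2mono Hke) as Mke.
pose proof (normal_epi_coker_of_kernel Ne Hke) as Hqe.
destruct (proj1 (proj2 Hke) _ m Hem) as [a Ha].
destruct Nm as [C [f Hf]].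
pose proof (is_2kernel_factor Mke Ha Hf) as Hfa.
destruct (HQ _ _ a) as [Qa [qa Hqa]].
pose proof (is_2cokernel_isomorphic_arg (isomorphic_sym Ha) Hqm) as Hqca.
destruct (proj1 (proj2 Hqa) _ (qm ∘ ke)) as [u Hu].
{ rewrite <- comp1A, Ha; apply Hqm. }
destruct (proj1 (proj2 Hqm) _ e Hem) as [v Hv].
assert (T : totally_normal_mono O a ke).
{ split; [split|split; [|split]].
  - exact (is_2kernel_2mono Hfa).
  - exact Mke.
  - now exists C, (f ∘ ke).
  - now exists R, e.
  - exists C, f; exact (is_2kernel_isomorphic (isomorphic_sym Ha) Hf). }
destruct (H _ _ _ a ke T _ _ _ qa qm e Hqa Hqca Hqe u v Hu Hv) as [Huv _].
exists Qa, qa, u; split; [|split].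
- now exists K, a.
- now exists R, v.
- now symmetry.
Qed.

Lemma self_dual_iff_cokernel_sequences (L : twocat) (O : L) :
  is_2z_exact O -> (homologically_self_dual O <-> cokernel_sequences_exact O).
Proof.
intros HL; split.
- apply self_dual_cokernel_sequences, HL.
- now apply cokernel_sequences_self_dual.
Qed.

Theorem proposition4p22 (L : twocat) (O : L) (HL : is_2z_exact O) :
  (homologically_self_dual O <-> cokernel_sequences_exact O) /\
  (homologically_self_dual O <-> kernel_sequences_exact O).
Proof.
split; [now apply self_dual_iff_cokernel_sequences|].
rewrite <- homologically_self_dual_op, <- cokernel_sequences_exact_op.
apply self_dual_iff_cokernel_sequences; now apply is_2z_exact_op.
Qed.
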